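(* Let $A=[a_{ij}]\in\mathcal{M}_n(\mathbb{C})$ and let $B\in\mathcal{B}(\mathcal{H})$, where $\mathcal{H}$ is a complex Hilbert space. Then $w(A\otimes B)\le w\left([c_{ij}]_{i,j=1}^n\right)$, where $$c_{ij}=\begin{cases}|a_{ii}|\,w(B) & \text{if } i=j,\\ \sqrt{(|a_{ij}|+|a_{ji}|)^2\|B\|^2-|a_{ij}a_{ji}|\left(\|B\|^2-w(B^2)\right)} & \text{if } i<j,\\ 0 & \text{if } i>j.\end{cases}$$
   Context: For a bounded operator $T$ on a complex Hilbert space, $w(T)=\sup\{|\langle Tx,x\rangle|:\|x\|=1\}$ is the numerical radius and $\|T\|$ the operator norm; complex $n\times n$ matrices are regarded as operators on $\mathbb{C}^n$. The Kronecker product of $A=[a_{ij}]\in\mathcal{M}_n(\mathbb{C})$ and $B\in\mathcal{B}(\mathcal{H})$ is the $n\times n$ operator matrix $A\otimes B=[a_{ij}B]_{i,j=1}^n$ acting on $\mathcal{H}^{\oplus n}\cong\mathbb{C}^n\otimes\mathcal{H}$. *)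

(* Defs.v *)
From HB Require Import structures.
From mathcomp Require Import all_boot all_order all_algebra sesquilinear.
From mathcomp Require Import complex.
From mathcomp Require Import all_classical all_reals all_analysis.

Set Implicit Arguments.
Unset Strict Implicit.
Unset Printing Implicit Defensive.

Import Order.TTheory GRing.Theory Num.Theory Num.Def.
Import numFieldNormedType.Exports.

Local Open Scope classical_set_scope.
Local Open Scope ring_scope.

(* Inner products [{dot V for conjC}] are linear in the first argument and
   conjugate-linear in the second. *)

Section Operators.
Context {R : realType} {V : lmodType R[i]}.
Variable ip : {dot V for conjC}.

Definition hnorm (x : V) : R := Num.sqrt (complex.Re (ip x x)).

(* [sup] is real-valued, with value 0 on sets that are empty or unbounded
   above; the two suprema below are finite for bounded [T], and over the
   trivial space the numerical radius is 0. *)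
Definition numerical_radius (T : V -> V) : R :=
  sup [set ComplexField.Normc.normc (ip (T x) x) | x in [set x | hnorm x = 1]].

Definition opnorm (T : V -> V) : R :=
  sup [set hnorm (T x) | x in [set x | hnorm x <= 1]].

End Operators.

Section EuclideanSpace.
Context {R : realType} (n : nat).
Implicit Types x y : 'cV[R[i]]_n.

Definition cdot x y : R[i] := \sum_i x i 0 * conjC (y i 0).

Fact cdot_bilinear : bilinear_for *%R (conjC \; *%R) cdot.
Proof.
split=> [y a u v | x a u v] /=; rewrite /cdot mulr_sumr -big_split /=.
  by apply: eq_bigr => i _; rewrite !mxE mulrDl mulrA.
by apply: eq_bigr => i _; rewrite !mxE rmorphD rmorphM mulrDr mulrCA.
Qed.
HB.instance Definition _ :=
  bilinear_isBilinear.Build _ _ _ _ _ _ cdot cdot_bilinear.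

Fact cdot_herm x y : cdot x y = (-1) ^+ false * conjC (cdot y x).
Proof.
rewrite expr0 mul1r /cdot rmorph_sum; apply: eq_bigr => i _.
by rewrite rmorphM /= conjCK mulrC.
Qed.
HB.instance Definition _ :=
  isHermitianSesquilinear.Build _ _ false conjC cdot cdot_herm.

Fact cdot_gt0 x : x != 0 -> 0 < cdot x x.
Proof.
move=> x0; have ge0 (i : 'I_n) : true -> 0 <= x i 0 * conjC (x i 0).
  by rewrite mul_conjC_ge0.
rewrite lt_def sumr_ge0 // andbT; apply: contra x0.
rewrite psumr_eq0 // => /allP x0; apply/eqP/matrixP => i j.
rewrite ord1 mxE; apply/eqP.
by have := x0 i (mem_index_enum i); rewrite /= mul_conjC_eq0.
Qed.
HB.instance Definition _ := isDotProduct.Build _ _ cdot cdot_gt0.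

End EuclideanSpace.

(* The orthogonal direct sum of n copies of V. *)
Section DirectSum.
Context {R : realType} {V : lmodType R[i]} (n : nat).
Variable ip : {dot V for conjC}.
Implicit Types x y : {ffun 'I_n -> V}.

Definition sumdot x y : R[i] := \sum_i ip (x i) (y i).

Fact sumdot_bilinear : bilinear_for *%R (conjC \; *%R) sumdot.
Proof.
split=> [y a u v | x a u v] /=; rewrite /sumdot mulr_sumr -big_split /=.
  by apply: eq_bigr => i _; rewrite !ffunE linearDl linearZl_LR.
by apply: eq_bigr => i _; rewrite !ffunE linearDr linearZr_LR.
Qed.
HB.instance Definition _ :=
  bilinear_isBilinear.Build _ _ _ _ _ _ sumdot sumdot_bilinear.

Fact sumdot_herm x y : sumdot x y = (-1) ^+ false * conjC (sumdot y x).
Proof.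
rewrite expr0 mul1r /sumdot rmorph_sum; apply: eq_bigr => i _.
by rewrite [LHS]hermC expr0 mul1r.
Qed.
HB.instance Definition _ :=
  isHermitianSesquilinear.Build _ _ false conjC sumdot sumdot_herm.

Fact sumdot_gt0 x : x != 0 -> 0 < sumdot x x.
Proof.
move=> x0; have ge0 (i : 'I_n) : true -> 0 <= ip (x i) (x i) by [].
rewrite lt_def sumr_ge0 // andbT; apply: contra x0.
rewrite psumr_eq0 // => /allP x0; apply/eqP/ffunP => i; rewrite ffunE.
apply/eqP; have := x0 i (mem_index_enum i); rewrite /=.
by apply: contraTT => /(neq0_dnorm_gt0 (s := ip)) /gt_eqF ->.
Qed.
HB.instance Definition _ := isDotProduct.Build _ _ sumdot sumdot_gt0.

End DirectSum.

Section Kronecker.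
Context {R : realType} {V : lmodType R[i]} {n : nat}.

Definition kron (A : 'M[R[i]]_n) (B : V -> V) (x : {ffun 'I_n -> V}) :
    {ffun 'I_n -> V} :=
  [ffun i => \sum_j A i j *: B (x j)].

Fact kron_linear (A : 'M[R[i]]_n) (B : {linear V -> V}) : linear (kron A B).
Proof.
move=> a x y; apply/ffunP => i; rewrite !ffunE scaler_sumr -big_split /=.
apply: eq_bigr => j _; rewrite !ffunE linearP scalerDr.
by rewrite !scalerA mulrC.
Qed.
HB.instance Definition _ A (B : {linear V -> V}) :=
  GRing.isLinear.Build _ _ _ _ (kron A B) (kron_linear A B).

End Kronecker.

(* Main.v *)
Require Import Defs.
From HB Require Import structures.
From mathcomp Require Import all_boot all_order all_algebra sesquilinear.
From mathcomp Require Import complex.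
From mathcomp Require Import all_classical all_reals all_analysis.
From mathcomp Require Import ring lra.

Set Implicit Arguments.
Unset Strict Implicit.
Unset Printing Implicit Defensive.

Import Order.TTheory GRing.Theory Num.Theory Num.Def.
Import numFieldNormedType.Exports.

Local Open Scope classical_set_scope.
Local Open Scope ring_scope.

(** Expanding the quadratic form of [kron A B] at [x] gives the double sum of
    the terms [A i j * ip (B (x j)) (x i)].  The diagonal terms are at most
    [normc (A i i) * w(B) * hnorm (x i) ^+ 2] by definition of the numerical
    radius, and the terms at [(i, j)] and [(j, i)] are estimated together.  If
    that pair is at most [c i j * (hnorm (x i) * hnorm (x j))], then the whole
    sum is at most the quadratic form of the matrix [c] at the vector [t] of the
    norms [hnorm (x i)].  This [t] is a unit vector as soon as [x] is one, so
    the bound is at most the numerical radius of [c].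

    The estimate of a pair (lemma [normc_pair_le]) rests on an inequality of
    Buzano type (lemma [buzano_le]):
      2 |<Tx, y>| |<Ty, x>| <= (|T|^2 + w(T^2)) |x|^2 |y|^2.
    It is usually obtained from the adjoint of [T].  Here the vector
    z = 2 <Tx, y> y - <y, y> Tx is used instead: it is <y, y> times the image of
    Tx under the reflection that fixes y, hence |z| = |y|^2 |Tx|, while
    <Tz, x> = 2 <Tx, y> <Ty, x> - <y, y> <T^2 x, x>.  With this inequality for
    the cross term, squaring |a| |<Ty, x>| + |b| |<Tx, y>| and using
    Cauchy-Schwarz for the two squares gives exactly the quantity under the
    square root in the definition of [c]. *)

Local Notation normc := ComplexField.Normc.normc.

(** * Moduli and suprema *)

Section Complex.
Context {R : realType}.
Implicit Types z : R[i].

Lemma norm_normc z : `|z| = (normc z)%:C%C.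
Proof. by case: z => a b; rewrite normc_def. Qed.

Lemma normc_ge0 z : 0 <= normc z.
Proof. by case: z => a b; apply: sqrtr_ge0. Qed.

Lemma normc_real (r : R) : normc r%:C%C = `|r|.
Proof. by rewrite /normc /= expr0n addr0 sqrtr_sqr. Qed.

Lemma normc_sum (I : Type) (s : seq I) (P : pred I) (F : I -> R[i]) :
  normc (\sum_(i <- s | P i) F i) <= \sum_(i <- s | P i) normc (F i).
Proof.
rewrite -lecR -norm_normc rmorph_sum /=.
rewrite (le_trans (ler_norm_sum _ _ _))// ler_sum// => i _; rewrite norm_normc.
Qed.

Lemma ler_normcD z1 z2 : normc (z1 + z2) <= normc z1 + normc z2.
Proof. exact: le_normcD. Qed.

End Complex.

(** Sets without a finite supremum are covered because [sup] is then 0. *)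
Lemma sup_ge0 {R : realType} (E : set R) :
  (forall x, E x -> 0 <= x) -> 0 <= sup E.
Proof.
move=> E0; have [supE|nsupE] := pselect (has_sup E); last by rewrite sup_out.
have [[x Ex] _] := supE.
by rewrite (le_trans (E0 _ Ex))// sup_upper_bound.
Qed.

(** [p] and [q] stand for |<Ty, x>| and |<Tx, y>|, and [h] for |x| |y|. *)
Lemma sqr_pair_le {F : realFieldType} (a b p q N W h : F) :
  0 <= a -> 0 <= b -> 0 <= p -> 0 <= q -> p <= N * h -> q <= N * h ->
  2 * (p * q) <= (N ^+ 2 + W) * h ^+ 2 ->
  (a * p + b * q) ^+ 2 <=
    h ^+ 2 * ((a + b) ^+ 2 * N ^+ 2 - a * b * (N ^+ 2 - W)).
Proof.
move=> a0 b0 p0 q0 pN qN pq.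
have sq t c : 0 <= t -> t <= N * h -> c ^+ 2 * t ^+ 2 <= c ^+ 2 * (N * h) ^+ 2.
  move=> t0 tN; rewrite ler_wpM2l ?sqr_ge0//.
  by apply: lerXn2r; rewrite ?nnegrE ?(le_trans t0).
have := ler_wpM2l (mulr_ge0 a0 b0) pq.
by move: (sq _ a p0 pN) (sq _ b q0 qN); lra.
Qed.

(** * Inner product spaces *)

Section InnerProduct.
Context {R : realType} {V : lmodType R[i]}.
Variable ip : {dot V for conjC}.
Implicit Types (x y u v : V) (a : R[i]).
Local Notation hnorm := (hnorm ip).

Lemma hnorm_ge0 x : 0 <= hnorm x.
Proof. exact: sqrtr_ge0. Qed.

Lemma ip_hnorm x : ip x x = (hnorm x ^+ 2)%:C%C.
Proof.
have := dnorm_ge0 ip x; rewrite lecE /= => /andP[/eqP im0 re0].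
by rewrite sqr_sqrtr// [LHS]complexE im0 mulr0 addr0.
Qed.

Lemma hnormZ a x : hnorm (a *: x) = normc a * hnorm x.
Proof.
apply/eqP; rewrite -(@eqrXn2 _ 2)// ?mulr_ge0 ?hnorm_ge0 ?normc_ge0//.
apply/eqP/complexI; rewrite -ip_hnorm dnormZ norm_normc ip_hnorm.
by rewrite exprMn -rmorphXn -rmorphM.
Qed.

Lemma hnorm_eq0 x : (hnorm x == 0) = (x == 0).
Proof.
rewrite -(dnorm_eq0 ip) ip_hnorm -sqrf_eq0.
by apply/eqP/eqP => [->|/complexI].
Qed.

Lemma ipC x y : ip y x = conjC (ip x y).
Proof. by rewrite hermC expr0 mul1r. Qed.

(** Expands the nonnegative square norm of <y, y> x - <x, y> y, which is
    |y|^2 (|x|^2 |y|^2 - |<x, y>|^2). *)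
Lemma hnorm_CauchySchwarz x y : normc (ip x y) <= hnorm x * hnorm y.
Proof.
have [->|y0] := eqVneq y 0.
  by rewrite linear0r ComplexField.Normc.normc0 mulr_ge0 ?hnorm_ge0.
have ny : 0 < hnorm y by rewrite lt_def hnorm_ge0 hnorm_eq0 y0.
rewrite -(@ler_pXn2r _ 2) ?nnegrE ?normc_ge0 ?mulr_ge0 ?hnorm_ge0//.
have := dnorm_ge0 ip (ip y y *: x - ip x y *: y).
rewrite dnormB !dnormZ linearZl_LR/= linearZr_LR /=.
have -> : conjC (ip x y) * ip x y = (normc (ip x y) ^+ 2)%:C%C.
  by rewrite mulrC -normCK norm_normc rmorphXn.
rewrite !ip_hnorm norm_normc -rmorphM norm_normc normc_real.
rewrite ger0_norm ?sqr_ge0// [conjC _]conjc_real.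
rewrite -!rmorphXn -!rmorphM -!rmorphD -rmorphN -rmorphD lecR.
set p := hnorm x; set q := hnorm y; set r := normc _ => h.
rewrite -subr_ge0 -(@pmulr_rge0 _ (q ^+ 2)) ?exprn_gt0//.
by apply: le_trans h _; rewrite le_eqVlt; apply/orP; left; apply/eqP; ring.
Qed.

(** The vector is [ip y y] times the image of [u] under the reflection that
    fixes [y] and negates its orthogonal complement. *)
Lemma hnorm_reflection u y :
  hnorm ((2 * ip u y) *: y - ip y y *: u) = hnorm y ^+ 2 * hnorm u.
Proof.
apply/eqP; rewrite -(@eqrXn2 _ 2)// ?mulr_ge0 ?sqr_ge0 ?hnorm_ge0//.
apply/eqP/complexI; rewrite -ip_hnorm.
rewrite dnormB !dnormZ linearZl_LR/= linearZr_LR /= [ip y u]ipC.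
have -> : 2 * ip u y * (conjC (ip y y) * conjC (ip u y)) =
   (2 * hnorm y ^+ 2 * normc (ip u y) ^+ 2)%:C%C.
  rewrite -mulrA (mulrCA (ip u y)) -normCK norm_normc ip_hnorm.
  rewrite [conjC _]conjc_real -(rmorph_nat (@real_complex R)).
  by rewrite -rmorphXn -!rmorphM mulrA.
rewrite [conjC _%:C%C]conjc_real normrM normr_nat !ip_hnorm !norm_normc.
rewrite normc_real ger0_norm ?sqr_ge0// -(rmorph_nat (@real_complex R)).
rewrite -!rmorphM -!rmorphXn -!rmorphM -!rmorphD -rmorphN -rmorphD.
by congr (_%:C%C); ring.
Qed.

Lemma numerical_radius_ge0 (S : V -> V) : 0 <= numerical_radius ip S.
Proof. by apply: sup_ge0 => _ [x _ <-]; exact: normc_ge0. Qed.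

Lemma opnorm_ge0 (S : V -> V) : 0 <= opnorm ip S.
Proof. by apply: sup_ge0 => _ [x _ <-]; exact: hnorm_ge0. Qed.

(** Without a uniform bound the supremum would be 0 by convention and the
    conclusion false. *)
Lemma normc_le_numerical_radius (S : V -> V) (M : R) :
  (forall x, hnorm x = 1 -> normc (ip (S x) x) <= M) ->
  forall x, hnorm x = 1 -> normc (ip (S x) x) <= numerical_radius ip S.
Proof.
move=> SM x x1; apply: ub_le_sup; last by exists x.
by exists M => _ [y /= y1 <-]; exact: SM.
Qed.

Lemma normc_hnormV x : normc (hnorm x)^-1%:C%C = (hnorm x)^-1.
Proof. by rewrite normc_real ger0_norm// invr_ge0 hnorm_ge0. Qed.

Lemma hnorm_normalized x : x != 0 -> hnorm ((hnorm x)^-1%:C%C *: x) = 1.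
Proof. by move=> x0; rewrite hnormZ normc_hnormV mulVf// hnorm_eq0. Qed.

Section BoundedOperator.
Variables (T : {linear V -> V}) (M : R).
Hypothesis TM : forall x, hnorm (T x) <= M * hnorm x.

Lemma hnorm_le_opnorm x : hnorm (T x) <= opnorm ip T * hnorm x.
Proof.
have [->|x0] := eqVneq x 0.
  by rewrite linear0 (eqP (_ : hnorm 0 == 0)) ?hnorm_eq0 ?mulr0.
have nx : 0 < hnorm x by rewrite lt_def hnorm_ge0 hnorm_eq0 x0.
rewrite -ler_pdivrMr//; apply: ub_le_sup.
  exists `|M| => _ [y /= y1 <-]; rewrite (le_trans (TM y))//.
  rewrite (le_trans (ler_wpM2r (hnorm_ge0 y) (ler_norm M)))//.
  by rewrite ler_piMr.
exists ((hnorm x)^-1%:C%C *: x) => /=; first by rewrite hnorm_normalized.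
by rewrite linearZ/= hnormZ normc_hnormV mulrC.
Qed.

Lemma normc_quadratic_le x :
  normc (ip (T x) x) <= numerical_radius ip T * hnorm x ^+ 2.
Proof.
have [->|x0] := eqVneq x 0.
  rewrite linear0r ComplexField.Normc.normc0.
  by rewrite mulr_ge0 ?sqr_ge0 ?numerical_radius_ge0.
have nx : 0 < hnorm x by rewrite lt_def hnorm_ge0 hnorm_eq0 x0.
have ub y : hnorm y = 1 -> normc (ip (T y) y) <= M.
  move=> y1; rewrite (le_trans (hnorm_CauchySchwarz _ _))// y1 mulr1.
  by rewrite -(mulr1 M) -y1.
have := normc_le_numerical_radius ub (hnorm_normalized x0).
rewrite linearZr_LR/= [conjC _]conjc_real [T _]linearZ/= linearZl_LR/=.
rewrite !ComplexField.Normc.normcM normc_hnormV mulrA -invfM mulrC -expr2.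
by rewrite ler_pdivrMr ?exprn_gt0.
Qed.

End BoundedOperator.

(** A Buzano-type inequality: with [z] the scaled reflection of [T x] in the
    line of [y], the product on the left splits as
    [ip (T z) x + ip y y * ip (T (T x)) x], whose two summands are bounded by
    the operator norm and by the numerical radius of the square of [T]. *)
Lemma buzano_le (T : {linear V -> V}) (M : R) :
  (forall x, hnorm (T x) <= M * hnorm x) ->
  forall x y, 2 * (normc (ip (T x) y) * normc (ip (T y) x)) <=
    (opnorm ip T ^+ 2 + numerical_radius ip (T \o T)) *
      (hnorm x ^+ 2 * hnorm y ^+ 2).
Proof.
move=> TM x y; set N := opnorm ip T; set W := numerical_radius _ _.
have TN := hnorm_le_opnorm TM; have N0 : 0 <= N := opnorm_ge0 T.
pose z := (2 * ip (T x) y) *: y - ip y y *: T x.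
have zx : 2 * (ip (T x) y * ip (T y) x) = ip (T z) x + ip y y * ip (T (T x)) x.
  have -> : T z = (2 * ip (T x) y) *: T y - ip y y *: T (T x).
    by rewrite /z linearB !linearZ.
  by rewrite linearBl (linearZl_LR ip) (linearZl_LR ip) subrK mulrA.
have hz : normc (ip (T z) x) <= N ^+ 2 * (hnorm x ^+ 2 * hnorm y ^+ 2).
  rewrite (le_trans (hnorm_CauchySchwarz _ _))//.
  apply: (@le_trans _ _ (N * (hnorm y ^+ 2 * (N * hnorm x)) * hnorm x)).
    rewrite ler_wpM2r ?hnorm_ge0// (le_trans (TN z))// ler_wpM2l//.
    by rewrite hnorm_reflection ler_wpM2l ?sqr_ge0.
  by rewrite le_eqVlt; apply/orP; left; apply/eqP; ring.
have TTM v : hnorm ((T \o T) v) <= N ^+ 2 * hnorm v.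
  by rewrite /= (le_trans (TN _))// expr2 -mulrA ler_wpM2l.
have hTT := normc_quadratic_le TTM x.
have -> : 2 * (normc (ip (T x) y) * normc (ip (T y) x)) =
    normc (2 * (ip (T x) y * ip (T y) x)).
  rewrite !ComplexField.Normc.normcM -(rmorph_nat (@real_complex R)).
  by rewrite [normc _%:C%C]normc_real normr_nat.
rewrite zx (le_trans (ler_normcD _ _))// mulrDl lerD//.
rewrite ComplexField.Normc.normcM ip_hnorm normc_real ger0_norm ?sqr_ge0//.
by rewrite mulrA [X in _ <= X]mulrC ler_wpM2l ?sqr_ge0.
Qed.

(** Applied to the coordinates [x i] and [x j], this is where the off-diagonal
    entries of the comparison matrix come from. *)
Lemma normc_pair_le (T : {linear V -> V}) (M : R) :
  (forall x, hnorm (T x) <= M * hnorm x) ->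
  forall (a b : R[i]) x y,
  normc (a * ip (T y) x + b * ip (T x) y) <=
    Num.sqrt ((normc a + normc b) ^+ 2 * opnorm ip T ^+ 2
      - normc (a * b) * (opnorm ip T ^+ 2 - numerical_radius ip (T \o T))) *
    (hnorm x * hnorm y).
Proof.
move=> TM a b x y; have := buzano_le TM x y.
have TN := hnorm_le_opnorm TM; have := opnorm_ge0 T.
set N := opnorm ip T; set W := numerical_radius _ _.
move=> N0 prod.
have yx : normc (ip (T y) x) <= N * (hnorm x * hnorm y).
  rewrite (le_trans (hnorm_CauchySchwarz _ _))// (mulrC (hnorm x)) mulrA.
  by rewrite ler_wpM2r ?hnorm_ge0.
have xy : normc (ip (T x) y) <= N * (hnorm x * hnorm y).
  rewrite (le_trans (hnorm_CauchySchwarz _ _))// mulrA.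
  by rewrite ler_wpM2r ?hnorm_ge0.
rewrite (le_trans (ler_normcD _ _))// !ComplexField.Normc.normcM.
have h0 : 0 <= hnorm x * hnorm y by rewrite mulr_ge0 ?hnorm_ge0.
have a0 := normc_ge0 a; have b0 := normc_ge0 b.
have p0 := normc_ge0 (ip (T y) x); have q0 := normc_ge0 (ip (T x) y).
have t0 : 0 <= normc a * normc (ip (T y) x) + normc b * normc (ip (T x) y).
  by rewrite addr_ge0 ?mulr_ge0.
(* The square root being monotone on the whole line, comparing the squares
   requires no information on the sign of the radicand. *)
rewrite -(ger0_norm t0) -(ger0_norm h0) -!sqrtr_sqr.
rewrite [leRHS]mulrC -sqrtrM ?sqr_ge0// ler_wsqrtr//.
rewrite [_ * normc (ip (T y) x)]mulrC -exprMn in prod.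
exact: sqr_pair_le.
Qed.

End InnerProduct.

(** * Finite sums and Euclidean vectors *)

Section Sums.
Context {R : realType} {n : nat}.

Lemma sum_pairs (W : nmodType) (f : 'I_n -> 'I_n -> W) :
  \sum_i \sum_j f i j =
  \sum_i f i i + \sum_(i < n) \sum_(j < n | (i < j)%N) (f i j + f j i).
Proof.
have swap : \sum_(i < n) \sum_(j < n | (j < i)%N) f i j =
    \sum_(i < n) \sum_(j < n | (i < j)%N) f j i.
  by rewrite (exchange_big_dep predT).
under [X in _ = _ + X]eq_bigr do rewrite big_split/=.
rewrite big_split/= -swap -!big_split/=; apply: eq_bigr => i _.
rewrite (bigD1 i)//= (bigID (fun j : 'I_n => (i < j)%N))/=.
by congr (_ + (_ + _)); apply: eq_bigl => j; rewrite -val_eqE /=; case: ltngtP.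
Qed.

(** Only the sums [g i j + g j i] are constrained off the diagonal, which lets
    a triangular array dominate a full one. *)
Lemma normc_sum_pairs (f : 'I_n -> 'I_n -> R[i]) (g : 'I_n -> 'I_n -> R) :
  (forall i, normc (f i i) <= g i i) ->
  (forall i j : 'I_n, (i < j)%N -> normc (f i j + f j i) <= g i j + g j i) ->
  normc (\sum_i \sum_j f i j) <= \sum_i \sum_j g i j.
Proof.
move=> fd fp; rewrite !sum_pairs (le_trans (ler_normcD _ _))// lerD//.
  by rewrite (le_trans (normc_sum _ _ _))// ler_sum.
rewrite (le_trans (normc_sum _ _ _))// ler_sum// => i _.
by rewrite (le_trans (normc_sum _ _ _))// ler_sum// => j; exact: fp.
Qed.

Lemma hnorm_cdot (x : 'cV[R[i]]_n) :
  hnorm (cdot (n:=n)) x ^+ 2 = \sum_i normc (x i 0) ^+ 2.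
Proof.
apply/complexI; rewrite -ip_hnorm rmorph_sum /=; apply: eq_bigr => i _.
by rewrite -normCK norm_normc rmorphXn.
Qed.

Lemma hnorm_sumdot (V : lmodType R[i]) (ip : {dot V for conjC})
    (x : {ffun 'I_n -> V}) :
  hnorm (sumdot (n:=n) ip) x ^+ 2 = \sum_i hnorm ip (x i) ^+ 2.
Proof.
apply/complexI; rewrite -ip_hnorm rmorph_sum /=; apply: eq_bigr => i _.
by rewrite ip_hnorm.
Qed.

Lemma cdot_mulmx (c : 'M[R[i]]_n) (x : 'cV[R[i]]_n) :
  cdot (c *m x) x = \sum_i \sum_j c i j * x j 0 * conjC (x i 0).
Proof. by apply: eq_bigr => i _; rewrite mxE mulr_suml. Qed.

Lemma normc_le_numerical_radius_mulmx (c : 'M[R[i]]_n) (x : 'cV[R[i]]_n) :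
  hnorm (cdot (n:=n)) x = 1 ->
  normc (cdot (c *m x) x) <= numerical_radius (cdot (n:=n)) (mulmx c).
Proof.
(* This bound works because the coordinates of a unit vector have modulus at
   most 1. *)
apply: (@normc_le_numerical_radius _ _ _ (mulmx c)
  (\sum_i \sum_j normc (c i j))) => {}x x1.
have xi1 i : normc (x i 0) <= 1.
  rewrite -(@ler_pXn2r _ 2) ?nnegrE ?normc_ge0//.
  rewrite expr1n -(expr1n _ 2) -x1 hnorm_cdot.
  by rewrite (bigD1 i)//= lerDl sumr_ge0// => j _; rewrite sqr_ge0.
rewrite [X in normc X](cdot_mulmx c x).
rewrite (le_trans (normc_sum _ _ _))// ler_sum// => i _.
rewrite (le_trans (normc_sum _ _ _))// ler_sum// => j _.
rewrite !ComplexField.Normc.normcM -mulrA ler_piMr ?normc_ge0//.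
rewrite mulr_ile1 ?normc_ge0//.
have := norm_normc (conjC (x i 0)).
by rewrite norm_conjC norm_normc => /complexI <-; exact: xi1.
Qed.

End Sums.

(** * The main inequality *)

Lemma bounded_hnorm (R : realType) (H : completeNormedModType R[i])
    (ip : {dot H for conjC}) (normE : forall x : H, `|x| = (hnorm ip x)%:C%C)
    (B : {linear H -> H}) (bndB : bounded_near B (nbhs (0 : H))) :
  exists M : R, forall x, hnorm ip (B x) <= M * hnorm ip x.
Proof.
have /linear_boundedP/pinfty_ex_gt0[M M0 BM] := bndB.
exists (complex.Re M) => x; have := BM x; rewrite !normE.
move: M0; rewrite ltcE /= => /andP[/eqP im0 _].
by rewrite [M in M * _]complexE im0 mulr0 addr0 -rmorphM lecR.
Qed.

Theorem corollary2p12 (R : realType) (H : completeNormedModType R[i])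
    (ip : {dot H for conjC})
    (normE : forall x : H, `|x| = (hnorm ip x)%:C%C)
    (n : nat) (A : 'M[R[i]]_n)
    (B : {linear H -> H}) (bndB : bounded_near B (nbhs (0 : H))) :
  let absC := @ComplexField.Normc.normc R in
  let w := numerical_radius ip in
  let N := opnorm ip B in
  let c : 'M[R[i]]_n := \matrix_(i < n, j < n)
    (if i == j then absC (A i i) * w B
     else if (i < j)%N then
       Num.sqrt ((absC (A i j) + absC (A j i)) ^+ 2 * N ^+ 2
                 - absC (A i j * A j i) * (N ^+ 2 - w (B \o B)))
     else 0)%:C%C in
  numerical_radius (sumdot (n:=n) ip) (kron A B)
    <= numerical_radius (cdot (n:=n)) (mulmx c).
Proof.
cbv zeta; set c := \matrix_(i, j) _; have [M BM] := bounded_hnorm normE bndB.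
(* The direct sum may be trivial: then no vector has norm 1 and the left-hand
   side is 0. *)
rewrite {1}/numerical_radius; set E := (X in sup X).
have [->|/set0P E0] := eqVneq E set0.
  by rewrite sup0 numerical_radius_ge0.
apply: ge_sup => // _ [x /= x1 <-].
pose t : 'cV[R[i]]_n := \col_i (hnorm ip (x i))%:C%C.
have t1 : hnorm (cdot (n:=n)) t = 1.
  apply/eqP; rewrite -(@eqrXn2 _ 2)// ?hnorm_ge0// hnorm_cdot expr1n.
  rewrite -(expr1n _ 2) -x1 hnorm_sumdot; apply/eqP/eq_bigr => i _.
  by rewrite mxE normc_real ger0_norm ?hnorm_ge0.
apply: le_trans (normc_le_numerical_radius_mulmx c t1).
pose g i j := complex.Re (c i j) * (hnorm ip (x i) * hnorm ip (x j)).
have cg : cdot (c *m t) t = (\sum_i \sum_j g i j)%:C%C.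
  rewrite cdot_mulmx rmorph_sum; apply: eq_bigr => i _.
  rewrite rmorph_sum; apply: eq_bigr => j _.
  rewrite /g !mxE [conjC _]conjc_real /= -!rmorphM; congr (_%:C%C).
  by rewrite -mulrA (mulrC (hnorm _ (x j))).
rewrite cg normc_real (le_trans _ (ler_norm _))//.
have -> : sumdot (n:=n) ip (kron A B x) x =
    \sum_i \sum_j A i j * ip (B (x j)) (x i).
  apply: eq_bigr => i _; rewrite ffunE linear_sumlz; apply: eq_bigr => j _.
  by rewrite linearZl_LR.
apply: normc_sum_pairs => [i|i j ij].
  rewrite /g mxE eqxx /= ComplexField.Normc.normcM -expr2 -mulrA.
  by rewrite ler_wpM2l ?normc_ge0// (normc_quadratic_le BM).
have ji : (j < i)%N = false by rewrite ltnNge ltnW.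
have nij : (i == j) = false by apply/negbTE; rewrite -val_eqE ltn_eqF.
rewrite /g !mxE nij (eq_sym j) nij ij ji /= mul0r addr0.
exact: normc_pair_le BM _ _ _ _.
Qed.
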